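(* The assignment $T_j\mapsto \hat T_j$ ($j=0,\ldots,n$) and $T_u\mapsto u$ ($u\in\Omega$, acting on $C(P)$ by $(uf)(\lambda)=f(u^{-1}\lambda)$) extends uniquely to a representation $h\mapsto \hat T(h)$ of the extended affine Hecke algebra $\mathcal H$ on $C(P)$ (i.e. to a unital algebra homomorphism $\mathcal H\to\operatorname{End}(C(P))$).
   Context: Let $R$ be an irreducible reduced crystallographic root system of rank $n$ spanning a real Euclidean space $V$ with inner product $\langle\cdot,\cdot\rangle$; $\alpha^\vee:=2\alpha/\langle\alpha,\alpha\rangle$; $P:=\{\lambda\in V:\langle\lambda,\alpha^\vee\rangle\in\mathbb Z\ \forall\alpha\in R\}$ is the weight lattice. Fix positive roots $R^+$ with simple roots $\alpha_1,\dots,\alpha_n$, and put $R^-:=-R^+$, $P^+:=\{\lambda\in P:\langle\lambda,\alpha^\vee\rangle\ge0\ \forall\alpha\in R^+\}$, $A:=\{x\in V:0<\langle x,\alpha^\vee\rangle<1\ \forall\alpha\in R^+\}$ (the alcove). Let $\alpha_0\in R^+$ be the root such that $\alpha_0^\vee$ is the highest root of $R^\vee$. For $\alpha\in R$, $k\in\mathbb Z$, $s_{\alpha,k}$ is the orthogonal reflection in the hyperplane $V_{\alpha,k}:=\{x:\langle x,\alpha^\vee\rangle=k\}$, $s_\alpha:=s_{\alpha,0}$, and $t_\lambda(x):=x+\lambda$. $W_0$ is the finite Weyl group (generated by the $s_\alpha$) and $W$ the extended affine Weyl group generated by $W_0$ and the $t_\lambda$, $\lambda\in P$. Put $s_0:=s_{\alpha_0,1}$,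 $s_j:=s_{\alpha_j,0}$ ($1\le j\le n$), and let $V_j$ be the hyperplane fixed by $s_j$. The length $\ell(w)$ of $w\in W$ is the number of hyperplanes $V_{\alpha,k}$ separating $A$ and $wA$; $\Omega:=\{u\in W: uA=A\}$; $W$ is generated by $\Omega$ and $s_0,\dots,s_n$. Parameters: $q:W\to\mathbb R\setminus\{0\}$ is length multiplicative ($q_{ww'}=q_wq_{w'}$ whenever $\ell(ww')=\ell(w)+\ell(w')$, and $q_w=1$ if $\ell(w)=0$); $q_j:=q_{s_j}$. The extended affine Hecke algebra $\mathcal H$ is the complex associative algebra with basis $T_w$ ($w\in W$) subject to $(T_j-q_j)(T_j+q_j^{-1})=0$ ($T_j:=T_{s_j}$, $0\le j\le n$) and $T_{ww'}=T_wT_{w'}$ whenever $\ell(ww')=\ell(w)+\ell(w')$; it is generated by $T_0,\dots,T_n$ and $T_u$, $u\in\Omega$. $C(P)$ denotes the space of all functions $P\to\mathbb C$, on which $W$ acts by $(wf)(\lambda):=f(w^{-1}\lambda)$. The difference-reflection operators are $\hat T_j:=q_j+\chi_j(s_j-1)$ ($0\le j\le n$), where $\chi_j$ acts by multiplication with the function $\chi_j(\lambda)=q_j$ if $V_j$ separates $\lambda$ and $A$, $\chi_j(\lambda)=1$ if $\lambda\in V_j$, and $\chi_j(\lambda)=q_j^{-1}$ otherwise. *)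

(* Defs.v *)
From HB Require Import structures.
From mathcomp Require Import all_boot all_order all_algebra.
From Stdlib Require Import ClassicalEpsilon.
Set Implicit Arguments. Unset Strict Implicit. Unset Printing Implicit Defensive.
Import Order.TTheory GRing.Theory Num.Theory.
Local Open Scope ring_scope.

Section Geometry.
Variables (R : archiRealFieldType) (n : nat).

Definition vec := 'rV[R]_n.
Definition ip (x y : vec) : R := (x *m y^T) 0 0.
Definition coroot (a : vec) : vec := (2 / ip a a) *: a.
Definition isZ (x : R) : bool := x \is a Num.int.

Record aff := Aff { amx : 'M[R]_n; avec : vec }.
Definition app (w : aff) (x : vec) : vec := x *m amx w + avec w.
Definition acomp (w w' : aff) : aff :=
  Aff (amx w' *m amx w) (avec w' *m amx w + avec w).
Definition aid : aff := Aff 1%:M 0.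
Definition ainv (w : aff) : aff :=
  Aff (invmx (amx w)) (- (avec w *m invmx (amx w))).
(* s_{a,k}: orthogonal reflection in V_{a,k} = {x | <x,a^vee> = k} *)
Definition refl (a : vec) (k : int) : aff :=
  Aff (1%:M - (coroot a)^T *m a) (k%:~R *: a).
Definition transl (l : vec) : aff := Aff 1%:M l.

Definition rootmx (rs : seq vec) : 'M[R]_(size rs, n) :=
  \matrix_(i < size rs) nth 0 rs i.

Definition irreducible_reduced_crystallographic_root_system (rs : seq vec) : Prop :=
  [/\ (0 : vec) \notin rs /\
      \rank (rootmx rs) = n,
      (forall a b, a \in rs -> b \in rs -> app (refl a 0) b \in rs),
      (forall a b, a \in rs -> b \in rs -> isZ (ip b (coroot a))),
      (forall a (c : R), a \in rs -> c *: a \in rs -> c = 1 \/ c = -1) &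
      (forall S : pred vec,
         (exists2 a, a \in rs & S a) -> (exists2 a, a \in rs & ~~ S a) ->
         ~ (forall a b, a \in rs -> b \in rs -> S a -> ~~ S b -> ip a b = 0))].

Variable rs : seq vec.
Variable simple : 'I_n -> vec.

Definition nonneg_comb (b : vec) : Prop :=
  exists c : 'I_n -> nat, b = \sum_(i < n) (c i)%:R *: simple i.

Definition simple_system : Prop :=
  [/\ (forall i, simple i \in rs),
      row_free (\matrix_(i < n) simple i) &
      (forall b, b \in rs -> nonneg_comb b \/ nonneg_comb (- b))].

Definition positive (b : vec) : Prop := b \in rs /\ nonneg_comb b.

Definition highest_coroot (a0 : vec) : Prop :=
  positive a0 /\
  forall b, b \in rs -> exists c : 'I_n -> nat,
    coroot a0 - coroot b = \sum_(i < n) (c i)%:R *: coroot (simple i).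

Definition inP (x : vec) : bool := all (fun a => isZ (ip x (coroot a))) rs.
Definition inA (x : vec) : Prop :=
  forall a, positive a -> 0 < ip x (coroot a) < 1.

Variable a0 : vec.

(* index j : option 'I_n; None stands for j = 0, Some i for j = i+1 *)
Definition hroot (j : option 'I_n) : vec :=
  match j with None => a0 | Some i => simple i end.
Definition hk (j : option 'I_n) : int := if j is None then 1 else 0.
Definition sgen (j : option 'I_n) : aff := refl (hroot j) (hk j).

Inductive inW : aff -> Prop :=
| inW1 : inW aid
| inWs a w : a \in rs -> inW w -> inW (acomp (refl a 0) w)
| inWt l w : inP l -> inW w -> inW (acomp (transl l) w).

Definition sepAw (a : vec) (k : int) (w : aff) : Prop :=
  ((forall x, inA x -> ip x (coroot a) < k%:~R) /\
   (forall x, inA x -> k%:~R < ip (app w x) (coroot a))) \/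
  ((forall x, inA x -> k%:~R < ip x (coroot a)) /\
   (forall x, inA x -> ip (app w x) (coroot a) < k%:~R)).

(* len w m : the number of hyperplanes V_{a,k} (a in R^+, k in Z; each
   hyperplane V_{b,k}, b in R, has exactly one such name) separating A and
   wA is m *)
Definition len (w : aff) (m : nat) : Prop :=
  exists s : seq (vec * int),
    [/\ uniq s, size s = m &
        forall a k, (a, k) \in s <-> (positive a /\ sepAw a k w)].

Definition inOmega (u : aff) : Prop :=
  [/\ inW u, (forall x, inA x -> inA (app u x)) &
      (forall y, inA y -> exists x, inA x /\ app u x = y)].

Variable C : numClosedFieldType.
Definition Pt := {x : vec | inP x}.
Definition fnP := Pt -> C.
Definition ext (f : fnP) (x : vec) : C :=
  match insub x with Some p => f p | None => 0 end.
Definition act (w : aff) (f : fnP) : fnP := fun l => ext f (app (ainv w) (val l)).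

Variable q : aff -> C.

Definition length_multiplicative_params : Prop :=
  [/\ (forall w, inW w -> q w \is Num.real /\ q w != 0),
      (forall w w' a b, inW w -> inW w' -> len w a -> len w' b ->
         len (acomp w w') (a + b)%N -> q (acomp w w') = q w * q w') &
      (forall w, inW w -> len w 0 -> q w = 1)].

Definition qj (j : option 'I_n) : C := q (sgen j).

Definition sepPt (j : option 'I_n) (l : vec) : Prop :=
  let c := coroot (hroot j) in let k : R := (hk j)%:~R in
  ((forall x, inA x -> ip x c < k) /\ k < ip l c) \/
  ((forall x, inA x -> k < ip x c) /\ ip l c < k).

Definition chi (j : option 'I_n) (l : vec) : C :=
  if ip l (coroot (hroot j)) == (hk j)%:~R then 1
  else if excluded_middle_informative (sepPt j l) then qj j else (qj j)^-1.

Definition That (j : option 'I_n) (f : fnP) : fnP :=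
  fun l => qj j * f l + chi j (val l) * (act (sgen j) f l - f l).

(* A representation of the extended affine Hecke algebra H on C(P), given by
   the images rho w of the basis elements T_w (w in W): a unital algebra
   homomorphism H -> End(C(P)) is exactly such a family of linear operators
   satisfying the defining relations of H. *)
Definition hecke_rep (rho : aff -> fnP -> fnP) : Prop :=
  [/\ (forall w, inW w -> forall (c : C) (f g : fnP) l,
          rho w (fun x => c * f x + g x) l = c * rho w f l + rho w g l),
      (forall f l, rho aid f l = f l),
      (forall w w' a b, inW w -> inW w' -> len w a -> len w' b ->
         len (acomp w w') (a + b)%N ->
         forall f l, rho (acomp w w') f l = rho w (rho w' f) l) &
      (forall j f l,
         let g : fnP := fun x => rho (sgen j) f x + (qj j)^-1 * f x in
         rho (sgen j) g l - qj j * g l = 0)].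

Definition extends_generators (rho : aff -> fnP -> fnP) : Prop :=
  (forall j f l, rho (sgen j) f l = That j f l) /\
  (forall u, inOmega u -> forall f l, rho u f l = act u f l).

End Geometry.

(* Main.v *)
Require Import Defs.
From HB Require Import structures.
From mathcomp Require Import all_boot all_order all_algebra.
From mathcomp Require Import ring lra zify.
From Stdlib Require Import ClassicalEpsilon FunctionalExtensionality.
Set Implicit Arguments. Unset Strict Implicit. Unset Printing Implicit Defensive.
Import Order.TTheory GRing.Theory Num.Theory.
Local Open Scope ring_scope.

(* For x in the closed alcove, f |-> (w |-> f(w x)) carries the operators on C(P)
   to the left action of the Hecke algebra on the functions on W, and every
   weight is some w x; so it suffices to see that on functions on W the product of
   generators along a reduced word depends on its end point w only.  There the
   left operators commute with right ones: they interact only where w A and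
   w s_j A lie on different sides of V_i, and then s_i w = w s_j, hence q_i = q_j.
   An operator commuting with all right operators is determined by its values at the
   identity, and for the inverse of a reduced word of w that value is F(w) / q_w.
   No braid relation has to be checked. *)

(** * Reflections *)

(** Each T_w has to act through a chosen reduced word, so the whole difficulty is independence of
    that choice. Weights obstruct a direct argument: a weight may have a nontrivial stabilizer, and
    [chi] takes a third value on a hyperplane. An open alcove meets no hyperplane, so on functions
    on [W] only the coefficients q_j and q_j^-1 occur and an element of [W] is its own coordinate.
    Inverses of words are used because T_j^-1 F takes the single value q_j^-1 F(s_j) at the
    identity, whereas T_j F would add (q_j - q_j^-1) F(1) and words would expand into sums. The
    equality of parameters of conjugate reflections is not assumed: it comes from computing [q] on
    s_i w = w s_j in two ways. *)

Section InnerProduct.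
Variables (R : archiRealFieldType) (n : nat).
Implicit Types x y z a b : vec R n.

Lemma ipE x y : ip x y = \sum_i x 0 i * y 0 i.
Proof. by rewrite /ip mxE; apply: eq_bigr => i _; rewrite mxE. Qed.

Lemma ipC x y : ip x y = ip y x.
Proof. by rewrite !ipE; apply: eq_bigr => i _; rewrite mulrC. Qed.

Lemma ipDl x y z : ip (x + y) z = ip x z + ip y z.
Proof. by rewrite /ip mulmxDl mxE. Qed.

Lemma ipZl c x y : ip (c *: x) y = c * ip x y.
Proof. by rewrite /ip -scalemxAl mxE. Qed.

Lemma ipNl x y : ip (- x) y = - ip x y.
Proof. by rewrite -scaleN1r ipZl mulN1r. Qed.

Lemma ipBl x y z : ip (x - y) z = ip x z - ip y z.
Proof. by rewrite ipDl ipNl. Qed.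

Lemma ipDr x y z : ip x (y + z) = ip x y + ip x z.
Proof. by rewrite ipC ipDl !(ipC _ x). Qed.

Lemma ipZr c x y : ip x (c *: y) = c * ip x y.
Proof. by rewrite ipC ipZl ipC. Qed.

Lemma ipNr x y : ip x (- y) = - ip x y.
Proof. by rewrite ipC ipNl ipC. Qed.

Lemma ipBr x y z : ip x (y - z) = ip x y - ip x z.
Proof. by rewrite ipDr ipNr. Qed.

Lemma ip_sumr x (I : finType) (F : I -> vec R n) :
  ip x (\sum_i F i) = \sum_i ip x (F i).
Proof.
rewrite /ip linear_sum mulmx_sumr summxE.
by apply: eq_bigr => i _.
Qed.

Lemma ip_gt0 x : x != 0 -> 0 < ip x x.
Proof.
move=> x0; rewrite ipE lt_def; apply/andP; split; last first.
  by apply: sumr_ge0 => i _; rewrite -expr2 sqr_ge0.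
apply: contra x0 => /eqP s0; apply/eqP/rowP => i; rewrite mxE; apply/eqP.
have p j : predT j -> 0 <= x 0 j * x 0 j by rewrite -expr2 sqr_ge0.
by move/eqP: (psumr_eq0P p s0 (i := i) isT); rewrite mulf_eq0 orbb.
Qed.

Lemma ip_ext x y : (forall z, ip z x = ip z y) -> x = y.
Proof.
move=> e; apply/eqP; rewrite -subr_eq0; apply/negP => /negP/ip_gt0.
by rewrite ipBr e subrr ltxx.
Qed.

Lemma corootE a : coroot a = (2 / ip a a) *: a. Proof. by []. Qed.

Lemma corootN a : coroot (- a) = - coroot a.
Proof. by rewrite !corootE ipNl ipNr opprK scalerN. Qed.

Lemma coroot_self a : a != 0 -> ip a (coroot a) = 2.
Proof. by move=> /ip_gt0 a0; rewrite corootE ipZr mulfVK // gt_eqF. Qed.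

Lemma coroot_inj a b : a != 0 -> b != 0 -> coroot a = coroot b -> a = b.
Proof.
move=> a0 b0 e.
have aa := ip_gt0 a0; have bb := ip_gt0 b0.
(* [coroot] is an involution: [c] is the coroot of its own coroot. *)
have ce (c : vec R n) : 0 < ip c c -> c = (2 / ip (coroot c) (coroot c)) *: coroot c.
  move=> cc; have c1 : ip c c != 0 by rewrite gt_eqF.
  rewrite corootE ipZl ipZr scalerA -[LHS]scale1r; congr (_ *: _).
  by field.
by rewrite (ce a) // (ce b) // e.
Qed.

Lemma appE (w : aff R n) x : app w x = x *m amx w + avec w. Proof. by []. Qed.

Lemma app_refl a k x : app (refl a k) x = x - (ip x (coroot a) - k%:~R) *: a.
Proof.
rewrite /app /refl /= mulmxBr mulmx1 mulmxA.
have -> : x *m (coroot a)^T *m a = ip x (coroot a) *: a.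
  by rewrite [x *m _]mx11_scalar mul_scalar_mx.
by rewrite scalerBl opprB addrA [LHS]addrAC.
Qed.

Lemma app_refl0 a x : app (refl a 0) x = x - ip x (coroot a) *: a.
Proof. by rewrite app_refl subr0. Qed.

Lemma ip_refl a x y : a != 0 ->
  ip (app (refl a 0) x) (app (refl a 0) y) = ip x y.
Proof.
move=> a0; rewrite !app_refl0 !ipBl !ipBr !ipZl !ipZr.
have aa : ip a a != 0 by rewrite gt_eqF ?ip_gt0.
by rewrite (ipC a y); field.
Qed.

Lemma reflK a k x : a != 0 -> app (refl a k) (app (refl a k) x) = x.
Proof.
move=> a0; rewrite !app_refl ipBl ipZl coroot_self //.
set t := ip x _; rewrite -addrA -opprD -scalerDl.
by rewrite (_ : t - k%:~R + _ = 0) ?scale0r ?subr0 //; ring.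
Qed.

Lemma coroot_refl a b : a != 0 ->
  coroot (app (refl a 0) b) = coroot b - ip a (coroot b) *: coroot a.
Proof.
move=> a0; rewrite {1}corootE ip_refl // app_refl0 scalerBr -corootE.
congr (_ - _); rewrite corootE !scalerA ipZr ipZr (ipC b a); congr (_ *: _).
ring.
Qed.

Lemma ip_coroot_refl a x b : a != 0 ->
  ip (app (refl a 0) x) (coroot b) = ip x (coroot (app (refl a 0) b)).
Proof.
by move=> a0; rewrite coroot_refl // app_refl0 ipBl ipZl ipBr ipZr mulrC.
Qed.

Lemma affP (u v : aff R n) : (forall x, app u x = app v x) -> u = v.
Proof.
case: u v => [M c] [N d]; rewrite /app /= => e.
have cd : c = d by have := e 0; rewrite !mul0mx !add0r.
rewrite cd in e *; congr Aff; apply/row_matrixP => i.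
by rewrite !rowE; apply: (addIr d).
Qed.

Lemma app_acomp (u v : aff R n) x : app (acomp u v) x = app u (app v x).
Proof. by rewrite /app /= mulmxDl mulmxA addrA. Qed.

Lemma app_aid x : app (aid R n) x = x.
Proof. by rewrite /app mulmx1 addr0. Qed.

Lemma acompA (u v w : aff R n) : acomp u (acomp v w) = acomp (acomp u v) w.
Proof. by apply: affP => x; rewrite !app_acomp. Qed.

Lemma acomp1w (w : aff R n) : acomp (aid R n) w = w.
Proof. by apply: affP => x; rewrite !app_acomp app_aid. Qed.

Lemma acompw1 (w : aff R n) : acomp w (aid R n) = w.
Proof. by apply: affP => x; rewrite !app_acomp app_aid. Qed.

(** [invmx] is total; a one-sided inverse certifies that the linear part is a unit, so that [ainv]
    is the true inverse. *)
Lemma ainv_eq (w v : aff R n) : acomp v w = aid R n -> ainv w = v.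
Proof.
case: w v => [M c] [N d]; rewrite /acomp /aid /ainv /= => -[MN cd].
have [uM uN] := mulmx1_unit MN.
have NE : N = invmx M by rewrite -[LHS](mulKmx uM) MN mulmx1.
by rewrite -NE -[in RHS](addrK (c *m N) d) (addrC d) cd sub0r.
Qed.

End InnerProduct.

(** * Walls of the alcove *)

Section Alcove.
Variables (R : archiRealFieldType) (n : nat) (rs : seq (vec R n)).
Variables (simple : 'I_n -> vec R n) (a0 : vec R n).
Hypothesis Hrs : irreducible_reduced_crystallographic_root_system rs.
Hypothesis Hsimple : simple_system rs simple.
Hypothesis Ha0 : highest_coroot rs simple a0.

Notation pos := (positive rs simple).
Notation alcove := (inA rs simple).
Implicit Types (a b x y : vec R n) (k : int) (j : option 'I_n).

Lemma root_neq0 a : a \in rs -> a != 0.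
Proof. by case: Hrs => -[h0 _] _ _ _ _ ars; apply: contra h0 => /eqP <-. Qed.

Lemma root_refl a b : a \in rs -> b \in rs -> app (refl a 0) b \in rs.
Proof. by case: Hrs => _ h _ _ _; apply: h. Qed.

Lemma root_int a b : a \in rs -> b \in rs -> ip b (coroot a) \is a Num.int.
Proof. by case: Hrs => _ _ h _ _; apply: h. Qed.

Lemma rootN a : a \in rs -> - a \in rs.
Proof.
move=> ars; have := root_refl ars ars.
by rewrite app_refl0 coroot_self ?root_neq0 // scaler_nat mulr2n opprD addNKr.
Qed.

Lemma simple_root i : simple i \in rs.
Proof. by case: Hsimple. Qed.

Lemma simple_free (c : 'I_n -> R) :
  \sum_i c i *: simple i = 0 -> forall i, c i = 0.
Proof.
case: Hsimple => _ /row_free_inj inj _ e i.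
have /inj/rowP/(_ i) : (\row_i c i) *m (\matrix_i simple i) = 0 *m (\matrix_i simple i).
  by rewrite mul0mx mulmx_sum_row -[RHS]e; apply: eq_bigr => l _; rewrite rowK mxE.
by rewrite !mxE.
Qed.

Lemma simple_pos i : pos (simple i).
Proof.
split; first exact: simple_root.
exists (fun l => (l == i) : nat); rewrite (bigD1 i) //= eqxx scale1r big1 ?addr0 //.
by move=> l /negPf ->; rewrite scale0r.
Qed.

Lemma pos_or_neg a : a \in rs -> pos a \/ pos (- a).
Proof.
move=> ars; case: Hsimple => _ _ /(_ _ ars) [h|h]; [left|right]; split => //.
exact: rootN.
Qed.

Lemma pos_coroot a : pos a ->
  exists2 d : 'I_n -> R,
    (forall i, 0 <= d i) & coroot a = \sum_i d i *: coroot (simple i).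
Proof.
case=> ars [c ca].
exists (fun i => (c i)%:R * ip (simple i) (simple i) / ip a a).
  move=> i; rewrite divr_ge0 ?mulr_ge0 ?ler0n ?ltW ?ip_gt0 ?root_neq0 //.
  exact: simple_root.
rewrite corootE {3}ca scaler_sumr; apply: eq_bigr => i _.
rewrite corootE !scalerA; congr (_ *: _).
have : ip (simple i) (simple i) != 0 by rewrite gt_eqF ?ip_gt0 ?root_neq0 ?simple_root.
have : ip a a != 0 by rewrite gt_eqF ?ip_gt0 ?root_neq0.
by move=> h1 h2; field; rewrite h1 h2.
Qed.

Lemma alcove_nonempty : exists x, alcove x.
Proof.
case: Hsimple => _; set M := \matrix_i simple i; rewrite row_free_unit => uM _.
(* [x] pairs to 1 with every simple root, so a positive root pairs with it to its height. Dividing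
   by [S], which exceeds every pairing with a coroot, brings these below 1. *)
pose x : vec R n := (invmx M *m const_mx 1)^T.
have xs i : ip x (simple i) = 1.
  rewrite ipC /ip trmxK; have <- : row i M = simple i by rewrite rowK.
  by rewrite -row_mul mulKVmx // !mxE.
have xpos a : pos a -> 0 < ip x (coroot a).
  case=> ars [c ca]; rewrite corootE ipZr mulr_gt0 ?divr_gt0 ?ip_gt0 ?root_neq0 //.
  have : ip x a = \sum_i (c i)%:R.
    by rewrite ca ip_sumr; apply: eq_bigr => i _; rewrite ipZr xs mulr1.
  move=> ->; rewrite lt_def sumr_ge0 ?andbT //; apply/negP => /eqP s0.
  have p i : predT i -> 0 <= (c i)%:R :> R by [].
  move/negP: (root_neq0 ars); apply; rewrite ca big1 // => i _.
  by rewrite (psumr_eq0P p s0) // scale0r.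
pose S := 1 + \sum_(a <- rs) `|ip x (coroot a)|.
have S0 : 0 < S by rewrite ltr_pwDl // sumr_ge0.
exists (S^-1 *: x) => a pa; rewrite ipZl mulr_gt0 ?invr_gt0 ?xpos //=.
rewrite mulrC ltr_pdivrMr // mul1r /S.
rewrite (big_rem a) /=; last by case: pa.
apply: le_lt_trans (ler_norm _) _.
by rewrite addrCA ltrDl ltr_pwDl // sumr_ge0.
Qed.

(** The affine coroot vanishing on V_{a,k}; its sign tells the side of the hyperplane. *)
Definition fa a k y : R := ip y (coroot a) - k%:~R.

Lemma fa_ext a b k l : a \in rs -> b \in rs ->
  (forall y, fa a k y = fa b l y) -> a = b /\ k = l.
Proof.
move=> ars brs e.
have kl : k = l.
  have := e 0; rewrite /fa /ip !mul0mx mxE !sub0r => /oppr_inj/eqP.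
  by rewrite eqr_int => /eqP.
split=> //; apply: coroot_inj; rewrite ?root_neq0 //; apply: ip_ext => z.
by have := e z; rewrite /fa kl => /addIr.
Qed.

Lemma faN a k y : fa (- a) (- k) y = - fa a k y.
Proof. by rewrite /fa corootN ipNr mulrNz opprB opprK addrC. Qed.

(* [aroot j] and [alevel j] name the affine simple coroot of [s_j], oriented so
   that it is positive on the alcove; for [s_0] it is [1 - <x, a0^vee>]. *)
Definition aroot j : vec R n := if j is Some i then simple i else - a0.
Definition alevel j : int := if j is Some _ then 0 else -1.
Definition phi j y : R := fa (aroot j) (alevel j) y.

Lemma a0_pos : pos a0.
Proof. by case: Ha0. Qed.

Lemma aroot_root j : aroot j \in rs.
Proof.
case: j => [i|] /=; first exact: simple_root.
by apply: rootN; case: a0_pos.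
Qed.

Lemma phi_Some i y : phi (Some i) y = ip y (coroot (simple i)).
Proof. by rewrite /phi /fa subr0. Qed.

Lemma phi_None y : phi None y = 1 - ip y (coroot a0).
Proof. by rewrite /phi /fa /= corootN ipNr mulrNz opprK addrC. Qed.

Notation s_ := (sgen simple a0).

Lemma app_sgen j y : app (s_ j) y = y - phi j y *: aroot j.
Proof.
rewrite /sgen app_refl; case: j => [i|]; first by rewrite phi_Some subr0.
by rewrite phi_None /= scalerN -scaleNr opprB.
Qed.

Lemma hroot_pos j : pos (hroot simple a0 j).
Proof. by case: j => [i|]; [exact: simple_pos|exact: a0_pos]. Qed.

Lemma hroot_root j : hroot simple a0 j \in rs.
Proof. by case: (hroot_pos j). Qed.

Lemma sgenK j y : app (s_ j) (app (s_ j) y) = y.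
Proof. by apply: reflK; apply: root_neq0; exact: hroot_root. Qed.

Lemma phi_sgen j y : phi j (app (s_ j) y) = - phi j y.
Proof.
rewrite app_sgen {1}/phi /fa ipBl ipZl coroot_self ?root_neq0 ?aroot_root //.
by rewrite /phi /fa; ring.
Qed.

Lemma highest_diff b : b \in rs ->
  exists c : 'I_n -> nat,
    coroot a0 - coroot b = \sum_i (c i)%:R *: coroot (simple i).
Proof. by case: Ha0 => _ h /h. Qed.

(** Positive coroots are nonnegative combinations of simple ones, which gives the lower bounds; the
    highest coroot dominates all others, so the single wall of [s_0] gives the upper ones. *)
Lemma phi_ge0_closure y : (forall j, 0 <= phi j y) ->
  forall a, pos a -> 0 <= ip y (coroot a) <= 1.
Proof.
move=> h a pa; apply/andP; split.
  have [d d0 ->] := pos_coroot pa; rewrite ip_sumr sumr_ge0 // => i _.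
  by rewrite ipZr mulr_ge0 // -phi_Some.
case: pa => ars _; have [c ce] := highest_diff ars.
have : 0 <= ip y (coroot a0 - coroot a).
  rewrite ce ip_sumr sumr_ge0 // => i _.
  by rewrite ipZr mulr_ge0 // -phi_Some.
have := h None; rewrite phi_None ipBr; lra.
Qed.

(** One point stands for the whole alcove: an affine coroot has constant sign there, so sides of
    hyperplanes are tested at [eta]. *)
Variable eta : vec R n.
Hypothesis Heta : alcove eta.

Lemma eta_pos a : pos a -> 0 < ip eta (coroot a) < 1.
Proof. exact: Heta. Qed.

(** Simple coroots are strictly positive at [eta], so a nonzero difference from the highest coroot
    is seen there. This strict maximality is how the highest coroot enters the analysis of [s_0]. *)
Lemma highest_eta b : b \in rs ->
  ip eta (coroot b) <= ip eta (coroot a0) ?= iff (b == a0).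
Proof.
move=> brs; have [c ce] := highest_diff brs.
have p i : predT i -> 0 <= (c i)%:R * ip eta (coroot (simple i)).
  by move=> _; rewrite mulr_ge0 ?ler0n //; case/andP: (eta_pos (simple_pos i)) => /ltW.
have e : ip eta (coroot a0) - ip eta (coroot b) = \sum_i (c i)%:R * ip eta (coroot (simple i)).
  by rewrite -ipBr ce ip_sumr; apply: eq_bigr => i _; rewrite ipZr.
split; first by rewrite -subr_ge0 e sumr_ge0.
apply/eqP/eqP => [eq|-> //].
have s0 : \sum_i (c i)%:R * ip eta (coroot (simple i)) = 0 by rewrite -e eq subrr.
apply: coroot_inj; rewrite ?root_neq0 //; first by case: a0_pos.
apply/esym/eqP; rewrite -subr_eq0 ce big1 // => i _.
have /eqP := psumr_eq0P p s0 (i := i) isT.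
by rewrite mulf_eq0 (gt_eqF (proj1 (andP (eta_pos (simple_pos i))))) orbF => /eqP ->; rewrite scale0r.
Qed.

(** The difference of [a] and its image is a multiple of [simple i]. Were the image negative, all
    other coefficients of [a] would vanish, and reducedness would force [a = simple i]. *)
Lemma simple_refl_pos i a :
  pos a -> a != simple i -> pos (app (refl (simple i) 0) a).
Proof.
move=> pa ai; have [ars [c ca]] := pa.
have brs := root_refl (simple_root i) ars.
split=> //; case: Hsimple => _ _ /(_ _ brs) [//|[d de]].
have li l : l != i -> c l = 0%N.
  move=> lNi.
  pose m := ip a (coroot (simple i)).
  have := @simple_free (fun l => (c l)%:R + (d l)%:R - m *+ (l == i)).
  move/(_ _ l); rewrite (negPf lNi) subr0 => H.
  have : (c l)%:R + (d l)%:R = 0 :> R.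
    apply: H; under eq_bigr do rewrite scalerBl scalerDl.
    rewrite sumrB big_split /= -ca -de app_refl0 opprB addrCA subrr addr0.
    rewrite (bigD1 i) //= eqxx mulr1n big1 ?addr0 ?subrr // => l' /negPf ->.
    by rewrite scale0r.
  by move/eqP; rewrite -natrD pnatr_eq0 addn_eq0 => /andP[/eqP].
have ae : a = (c i)%:R *: simple i.
  by rewrite ca (bigD1 i) //= big1 ?addr0 // => l /li ->; rewrite scale0r.
case: Hrs => _ _ _ /(_ (simple i) (c i)%:R (simple_root i)); rewrite -ae => /(_ ars).
move=> h _; case: h => ce; first by rewrite ae ce scale1r eqxx in ai.
by have := ler0n R (c i); rewrite ce oppr_ge0 ler10.
Qed.

Lemma sgen_eta_pos j a : pos a -> a != hroot simple a0 j ->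
  0 < ip (app (s_ j) eta) (coroot a) < 1.
Proof.
move=> pa; case: j => [i|] /= ne.
  rewrite /sgen /= ip_coroot_refl ?root_neq0 ?simple_root //.
  exact/eta_pos/simple_refl_pos.
have ars : a \in rs by case: pa.
have a0rs : a0 \in rs by case: a0_pos.
(* For [s_0] everything depends on m = <a0, a^vee>, which is shown to be 0 or 1 without root
   strings: the coroots of s_a(a0) and of -s_{a0}(a) are compared at [eta] with the highest one,
   giving m >= 0 and m < 2. *)
have /intrP[m me] := root_int ars a0rs.
rewrite app_sgen phi_None /= scalerN opprK ipDl ipZl me.
have h0 := eta_pos a0_pos; have h1 := eta_pos pa.
have lt : ip eta (coroot a) < ip eta (coroot a0).
  by rewrite (lt_leif (highest_eta ars)).
have m0 : 0 <= m%:~R :> R.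
  have [+ _] := highest_eta (root_refl ars a0rs).
  rewrite coroot_refl ?root_neq0 // ipBr ipZr gerBl => h.
  have : 0 <= ip a (coroot a0) by rewrite -(pmulr_lge0 _ (proj1 (andP h1))).
  rewrite -me !corootE !ipZr (ipC a) => h2.
  have aa : 0 < 2 / ip a a by rewrite divr_gt0 ?ip_gt0 ?root_neq0.
  have bb : 0 < 2 / ip a0 a0 by rewrite divr_gt0 ?ip_gt0 ?root_neq0.
  by rewrite (pmulr_rge0 _ aa) -(pmulr_rge0 _ bb).
have m1 : m%:~R * ip eta (coroot a0) <= ip eta (coroot a) + ip eta (coroot a0).
  have [+ _] := highest_eta (rootN (root_refl a0rs ars)).
  rewrite corootN coroot_refl ?root_neq0 // ipNr ipBr ipZr me; lra.
have {}m1 : m < 2.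
  rewrite ltNge; apply/negP => m2; have : 2%:~R <= m%:~R :> R by rewrite ler_int.
  rewrite -(ler_pM2r (proj1 (andP h0))); lra.
move: m0; rewrite ler0z; move: m1.
case: m {me} => [[|[|m]]|m] // _ _; lra.
Qed.

(** Every positive coroot other than that of [hroot j] has values strictly between 0 and 1 at both
    [eta] and its image, so no integer level is crossed: V_j is the only hyperplane between A and
    s_j A. *)
Lemma sgen_separates j a k : a \in rs ->
  0 < fa a k eta -> fa a k (app (s_ j) eta) < 0 -> a = aroot j /\ k = alevel j.
Proof.
move=> ars; rewrite /fa => h1 h2.
have between (l m : int) : l%:~R < k%:~R :> R -> k%:~R < m%:~R :> R -> l < k < m.
  by rewrite !ltr_int => -> ->.
have hj := eta_pos (hroot_pos j).
have a0E y : ip y (coroot a0) = 1 - phi None y by rewrite phi_None; ring.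
have [e|ne] := eqVneq a (hroot simple a0 j).
  case: j e hj h1 h2 => [i|] /= -> hj.
    rewrite -!phi_Some phi_sgen phi_Some => h1 h2; split=> //.
    have : -1 < k < 1 by apply: between; lra.
    lia.
  by rewrite /= !a0E phi_sgen =>  h1 h2; exfalso; rewrite a0E in hj; lra.
have [e|ne'] := eqVneq (- a) (hroot simple a0 j).
  have ae : a = - hroot simple a0 j by rewrite -e opprK.
  rewrite {ne e}ae in ars h1 h2 *; rewrite !corootN !ipNr in h1 h2.
  case: j hj h1 h2 {ars} => [i|] /= hj.
    by rewrite -!phi_Some phi_sgen phi_Some => h1 h2; exfalso; lra.
  rewrite !a0E phi_sgen => h1 h2; split=> //; rewrite a0E in hj.
  have : -2 < k < 0 by apply: between; lra.
  by rewrite /alevel; lia.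
exfalso; case: (pos_or_neg ars) => pa.
  have h3 := sgen_eta_pos pa ne; have h4 := eta_pos pa.
  by have : 0 < k < 1 by [apply: between; lra]; lia.
have := sgen_eta_pos pa ne'; have := eta_pos pa.
rewrite corootN !ipNr => h3 h4.
by have : -1 < k < 0 by [apply: between; lra]; lia.
Qed.

Lemma fa_eta_neq0 a k : a \in rs -> fa a k eta != 0.
Proof.
have key b l : pos b -> fa b l eta != 0.
  move=> /eta_pos h; rewrite /fa subr_eq0; apply/eqP => e.
  by move: h; rewrite e ltr0z ltrz1; lia.
move=> ars; case: (pos_or_neg ars) => [/(key _ k)//|/(key _ (- k))].
by rewrite faN oppr_eq0.
Qed.

Lemma fa_alcove x a k : alcove x -> a \in rs -> (fa a k x < 0) = (fa a k eta < 0).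
Proof.
move=> xA; have key b l : pos b -> (fa b l x < 0) = (fa b l eta < 0) /\
    (fa b l x > 0) = (fa b l eta > 0).
  move=> pb; have := xA _ pb; have := eta_pos pb; rewrite /fa => h1 h2.
  have [l0|l1] := leP l 0.
    have : l%:~R <= 0 :> R by rewrite lerz0.
    by move=> h3; split; apply/idP/idP => h4; lra.
  have : 1 <= l%:~R :> R by rewrite ler1z.
  by move=> h3; split; apply/idP/idP => h4; lra.
move=> ars; case: (pos_or_neg ars) => [/(key _ k)[]//|/(key _ (- k))[_]].
by rewrite !faN !oppr_gt0.
Qed.

(** * The extended affine Weyl group acting on weights and affine coroots *)

Notation W := (inW rs).

(* [a] being the image of [b] under the linear part of [w] makes [b] determine
   the reflection: [w s_(b,l) w^-1 = s_(a,k)]. *)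
Lemma fa_inW w a k : W w -> a \in rs ->
  exists b l, [/\ b \in rs, b *m amx w = a & forall y, fa a k (app w y) = fa b l y].
Proof.
move=> Ww; elim: Ww a k => [|c v crs Wv IH|c v cP Wv IH] a k ars.
- by exists a, k; split=> [//||y]; rewrite ?mulmx1 // app_aid.
- have c0 := root_neq0 crs.
  have [b [l [brs ba be]]] := IH _ k (root_refl crs ars).
  exists b, l; split=> // [|y].
    rewrite /= mulmxA ba -[RHS](reflK 0 a c0).
    by rewrite [RHS]appE /= [_ *: _]scale0r addr0.
  rewrite app_acomp -be /fa; congr (_ - _).
  by rewrite ip_coroot_refl.
- have /intrP[m me] : ip c (coroot a) \is a Num.int by move/allP: cP => /(_ _ ars).
  have [b [l [brs ba be]]] := IH _ (k - m) ars.
  exists b, l; split=> // [|y]; first by rewrite /= mulmx1.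
  rewrite app_acomp -be /fa {1}/app /= mulmx1 ipDl me rmorphB /=; ring.
Qed.

Lemma W_inP w y : W w -> inP rs y -> inP rs (app w y).
Proof.
move=> Ww /allP yP; apply/allP => a ars.
have [b [l [brs _ /(_ y)]]] := fa_inW 0 Ww ars.
rewrite /fa subr0 /isZ => ->; apply: rpredB; first exact: yP.
exact: intr_int.
Qed.

Lemma W_mul w v : W w -> W v -> W (acomp w v).
Proof.
move=> Ww Wv; elim: Ww => [|c u crs Wu IH|c u cP Wu IH].
- by rewrite acomp1w.
- by rewrite -acompA; apply: inWs.
- by rewrite -acompA; apply: inWt.
Qed.

Lemma W_refl0 a : a \in rs -> W (refl a 0).
Proof. by move=> ars; rewrite -[refl a 0]acompw1; apply: inWs => //; apply: inW1. Qed.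

Lemma W_transl l : inP rs l -> W (transl l).
Proof. by move=> lP; rewrite -[transl l]acompw1; apply: inWt => //; apply: inW1. Qed.

Lemma W_sgen j : W (s_ j).
Proof.
case: j => [i|]; first exact: W_refl0 (simple_root i).
have a0rs := proj1 a0_pos.
(* [s_0] is a reflection through the origin followed by the translation by [a0], a weight because
   the root system is crystallographic. *)
have -> : s_ None = acomp (transl a0) (refl a0 0).
  apply: affP => x; rewrite app_acomp [app (transl _) _]/app /= mulmx1 [LHS]app_refl app_refl0 /=.
  by rewrite scalerBl scale1r opprB addrCA addrC addrAC.
apply: W_mul (W_refl0 a0rs); apply/W_transl/allP => b brs.
exact: root_int.
Qed.

Lemma W_inv_ex w : W w ->
  exists v, [/\ W v, acomp v w = aid R n & acomp w v = aid R n].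
Proof.
elim=> [|c u crs Wu [v [Wv vu uv]]|c u cP Wu [v [Wv vu uv]]].
- by exists (aid R n); rewrite acomp1w; split=> //; apply: inW1.
- have cc : acomp (refl c 0) (refl c 0) = aid R n.
    by apply: affP => x; rewrite app_acomp reflK ?app_aid ?root_neq0.
  exists (acomp v (refl c 0)); split; first exact: W_mul (W_refl0 crs).
    by rewrite -acompA (acompA _ _ u) cc acomp1w.
  by rewrite -acompA (acompA u) uv acomp1w.
- have NcP : inP rs (- c).
    apply/allP => a ars; rewrite /isZ ipNl rpredN.
    by move/allP: cP => /(_ _ ars).
  have cc d : acomp (transl d) (transl (- d)) = aid R n.
    by apply: affP => x; rewrite app_acomp /app /= !mulmx1 addr0 subrK.
  exists (acomp v (transl (- c))); split; first exact: W_mul (W_transl NcP).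
    by rewrite -acompA (acompA _ _ u) -{2}[c]opprK cc acomp1w.
  by rewrite -acompA (acompA u) uv acomp1w.
Qed.

Lemma W_ainv w : W w -> [/\ W (ainv w), acomp (ainv w) w = aid R n
  & acomp w (ainv w) = aid R n].
Proof. by move=> /W_inv_ex[v [Wv vw wv]]; rewrite (ainv_eq vw). Qed.

Lemma fa_alcove_gt0 x a k : alcove x -> a \in rs -> (0 < fa a k x) = (0 < fa a k eta).
Proof. by move=> xA ars; rewrite -!oppr_lt0 -!faN fa_alcove ?rootN. Qed.

Lemma phi_eta j : 0 < phi j eta.
Proof.
case: j => [i|]; first by rewrite phi_Some; case/andP: (eta_pos (simple_pos i)).
by rewrite phi_None subr_gt0; case/andP: (eta_pos a0_pos).
Qed.

Lemma closure_fa_ge0 y a k : (forall j, 0 <= phi j y) -> a \in rs ->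
  0 < fa a k eta -> 0 <= fa a k y.
Proof.
move=> /phi_ge0_closure yA ars; rewrite /fa => h.
case: (pos_or_neg ars) => pa; have := yA _ pa; have := eta_pos pa; rewrite ?corootN ?ipNr => h1 h2.
  have : k%:~R < 1%:~R :> R by lra.
  rewrite ltr_int => k1; have : k%:~R <= 0 :> R by rewrite lerz0; lia.
  lra.
have : k%:~R < 0%:~R :> R by lra.
rewrite ltr_int => k1; have : k%:~R <= - 1 :> R by rewrite -[-1](mulrNz 1 1) ler_int; lia.
lra.
Qed.

(** * Length *)

(* The affine coroots that are positive on the alcove and negative at [y]: every
   hyperplane separating [y] from the alcove is named exactly once. *)
Definition separating y : seq (vec R n * int) :=
  undup [seq p <- [seq (a, Num.floor (ip y (coroot a)) + (i : nat)%:Z) |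
                    a <- rs, i <- iota 0 (`|Num.floor (ip y (coroot a))| + 2)] |
         (0 < fa p.1 p.2 eta) && (fa p.1 p.2 y < 0)].

Lemma mem_separating y p : (p \in separating y) =
  [&& p.1 \in rs, 0 < fa p.1 p.2 eta & fa p.1 p.2 y < 0].
Proof.
case: p => a k.
rewrite mem_undup mem_filter /= andbC; apply/andP/andP => -[].
  by move=> /flatten_mapP[b brs /mapP[i _ [-> _]]].
move=> ars /andP[h1 h2]; split; last by apply/andP.
apply/flatten_mapP; exists a => //; apply/mapP; set f := Num.floor (ip y (coroot a)).
(* The level lies strictly between [f] and 1, hence the finite range searched in [separating]
   contains it. *)
have fk : f < k.
  rewrite -(ltr_int R) (le_lt_trans (floor_le _)) //.
  by move: h2; rewrite /fa subr_lt0.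
have k1 : k < 1.
  rewrite -(ltr_int R); move: h1; rewrite /fa subr_gt0 => /lt_trans; apply.
  case: (pos_or_neg ars) => /eta_pos; rewrite ?corootN ?ipNr; lra.
exists `|k - f|%N; first by rewrite mem_iota /=; lia.
by congr pair; lia.
Qed.

Definition dist y : nat := size (separating y).

(** The action of [s_j] on affine coroots. Only the translation part of [s_0] shifts the level, by
    an integral pairing that [Num.floor] merely casts to [int]. *)
Definition srefl j (p : vec R n * int) : vec R n * int :=
  (app (refl (hroot simple a0 j) 0) p.1,
   p.2 - hk j * Num.floor (ip (hroot simple a0 j) (coroot p.1))).

Lemma srefl_root j p : p.1 \in rs -> (srefl j p).1 \in rs.
Proof. exact/root_refl/hroot_root. Qed.

Lemma fa_srefl j p y : p.1 \in rs ->
  fa (srefl j p).1 (srefl j p).2 y = fa p.1 p.2 (app (s_ j) y).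
Proof.
move=> prs; rewrite /fa /= -ip_coroot_refl ?root_neq0 ?hroot_root //.
rewrite /sgen app_refl0 app_refl !ipBl !ipZl rmorphB rmorphM /=.
by rewrite floorK ?root_int ?hroot_root //; ring.
Qed.

Lemma sreflK j p : p.1 \in rs -> srefl j (srefl j p) = p.
Proof.
move=> prs; have prs' := srefl_root j prs.
have h y : fa (srefl j (srefl j p)).1 (srefl j (srefl j p)).2 y = fa p.1 p.2 y.
  by rewrite !fa_srefl // sgenK.
have [e1 e2] := fa_ext (srefl_root j prs') prs h.
by rewrite [LHS]surjective_pairing e1 e2 -surjective_pairing.
Qed.

(** By [sgen_separates], [srefl j] preserves positivity on the alcove except for the affine coroot
    of [s_j] itself. It therefore matches the hyperplanes for s_j y with those for y other than
    V_j. *)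
Lemma dist_sgen j y : phi j y < 0 -> dist y = (dist (app (s_ j) y)).+1.
Proof.
move=> py; set y' := app _ y.
pose S := (aroot j, alevel j) :: map (srefl j) (separating y').
have sep_rs z p : p \in separating z -> p.1 \in rs.
  by rewrite mem_separating => /andP[].
have srefl_pos p : p.1 \in rs -> 0 < fa p.1 p.2 eta -> p <> (aroot j, alevel j) ->
    0 < fa (srefl j p).1 (srefl j p).2 eta.
  move=> prs h1 ne; rewrite lt_def fa_eta_neq0 ?srefl_root //= fa_srefl // leNgt.
  apply/negP => /(sgen_separates prs h1)[e1 e2]; apply: ne.
  by rewrite [p]surjective_pairing e1 e2.
have other p : p \in separating y' -> p <> (aroot j, alevel j).
  rewrite mem_separating => /and3P[_ _ +] e; rewrite e /= -/(phi j y') phi_sgen; lra.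
suff /perm_size : perm_eq (separating y) S by rewrite /= size_map.
apply: uniq_perm; first exact: undup_uniq.
  rewrite /S /=; apply/andP; split; last first.
    rewrite map_inj_in_uniq ?undup_uniq // => p p' /sep_rs prs /sep_rs prs' e.
    by rewrite -(sreflK j prs) e sreflK.
  apply/mapP => -[p pS e]; have prs := sep_rs _ _ pS.
  move: (pS); rewrite mem_separating => /and3P[_ + _].
  rewrite -{1 2}(sreflK j prs) -e fa_srefl ?aroot_root //= -/(phi j _) phi_sgen.
  by have := phi_eta j; lra.
move=> p; rewrite inE mem_separating; apply/and3P/orP.
  case=> prs h1 h2; have [->|/eqP ne] := eqVneq p (aroot j, alevel j); first by left.
  right; apply/mapP; exists (srefl j p); last by rewrite sreflK.
  by rewrite mem_separating srefl_root // srefl_pos // fa_srefl //= sgenK.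
case=> [/eqP->|/mapP[p' pS ->]].
  by split; rewrite ?aroot_root // -/(phi _ _) ?phi_eta.
have prs := sep_rs _ _ pS.
move: (pS); rewrite mem_separating => /and3P[_ h1 h2].
split; first exact: srefl_root.
  by apply: srefl_pos => //; apply: other.
by rewrite fa_srefl.
Qed.

Lemma dist_gt0 y : (0 < dist y)%N -> exists j, phi j y < 0.
Proof.
rewrite /dist; case e : (separating y) => [//|[a k] t] _.
have : (a, k) \in separating y by rewrite e mem_head.
rewrite mem_separating => /and3P[ars h1 h2]; apply: NNPP => no.
have : 0 <= fa a k y.
  apply: closure_fa_ge0 => // j; rewrite leNgt; apply/negP => h; apply: no.
  by exists j.
by rewrite leNgt h2.
Qed.

Definition lng (w : aff R n) : nat := dist (app w eta).
(** Left descents in geometric form: V_j separates A from wA exactly when s_j shortens w. *)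
Definition desc j (w : aff R n) : bool := phi j (app w eta) < 0.

Lemma lng1 : lng (aid R n) = 0%N.
Proof.
rewrite /lng app_aid; apply/eqP; rewrite -leqn0 leqNgt; apply/negP => /dist_gt0[j].
by rewrite ltNge ltW ?phi_eta.
Qed.

Lemma fa_W_neq0 w a k : W w -> a \in rs -> fa a k (app w eta) != 0.
Proof.
by move=> Ww ars; have [b [l [brs _ ->]]] := fa_inW k Ww ars; apply: fa_eta_neq0.
Qed.

Lemma desc_sgen j w : W w -> desc j (acomp (s_ j) w) = ~~ desc j w.
Proof.
move=> Ww; have := fa_W_neq0 (alevel j) Ww (aroot_root j).
by rewrite /desc app_acomp phi_sgen oppr_lt0 -/(phi _ _); case: ltgtP.
Qed.

Lemma sgen2 j : acomp (s_ j) (s_ j) = aid R n.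
Proof. by apply: affP => x; rewrite app_acomp sgenK app_aid. Qed.

Lemma sgenKl j w : acomp (s_ j) (acomp (s_ j) w) = w.
Proof. by rewrite acompA sgen2 acomp1w. Qed.

Lemma lng_desc j w : desc j w -> lng w = (lng (acomp (s_ j) w)).+1.
Proof. by move=> h; rewrite /lng (dist_sgen h) app_acomp. Qed.

Lemma lng_asc j w : W w -> ~~ desc j w -> lng (acomp (s_ j) w) = (lng w).+1.
Proof. by move=> Ww h; rewrite (@lng_desc j) ?sgenKl // desc_sgen. Qed.

Lemma lng_gt0 w : (0 < lng w)%N -> exists j, desc j w.
Proof. exact: dist_gt0. Qed.

Lemma desc1 j : desc j (aid R n) = false.
Proof. by rewrite /desc app_aid; apply/negbTE; rewrite -leNgt ltW ?phi_eta. Qed.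

Lemma lng_sgen j : lng (s_ j) = 1%N.
Proof.
by rewrite -[s_ j]acompw1 lng_asc ?lng1 ?desc1 //; exact: inW1.
Qed.

Lemma fa_gt0_alcove y :
  (forall a k, a \in rs -> 0 < fa a k eta -> 0 < fa a k y) -> alcove y.
Proof.
move=> h a pa; have [ars _] := pa; have e := eta_pos pa.
have h1 := h _ 0 ars; have h2 := h _ (- 1) (rootN ars).
rewrite !faN /fa !mulr1z !mulr0z !subr0 !oppr_gt0 in h1 h2.
have /andP[h3 h4] := e; rewrite h1 //= -subr_lt0 h2 //; lra.
Qed.

Lemma lng0_alcove z : W z -> lng z = 0%N -> alcove (app z eta).
Proof.
move=> Wz /eqP; rewrite size_eq0 => /eqP z0.
apply: fa_gt0_alcove => a k ars h.
rewrite lt_def fa_W_neq0 //= leNgt; apply/negP => h'.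
have : (a, k) \in separating (app z eta) by rewrite mem_separating ars h h'.
by rewrite z0.
Qed.

Lemma desc_mulr j w z : W w -> W z -> lng z = 0%N ->
  desc j (acomp w z) = desc j w.
Proof.
move=> Ww Wz /(lng0_alcove Wz) zA; rewrite /desc app_acomp /phi.
have [b [l [brs _ e]]] := fa_inW (alevel j) Ww (aroot_root j).
by rewrite !e fa_alcove.
Qed.

(** The folding condition. If the affine coroot of s_i, pulled back along w, changes sign between A
    and s_j A, it is plus or minus that of s_j by [sgen_separates]; hence w conjugates s_j into s_i.
    Evaluating the same identity at w^-1 eta compares the descents. *)
Lemma desc_switch i j w : W w -> desc i (acomp w (s_ j)) != desc i w ->
  acomp (s_ i) w = acomp w (s_ j) /\ desc i w = desc j (ainv w).
Proof.
move=> Ww; have [Wi vw wv] := W_ainv Ww.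
have [b [l [brs ba e]]] := fa_inW (alevel i) Ww (aroot_root i).
have wvE : app w (app (ainv w) eta) = eta by rewrite -app_acomp wv app_aid.
have swap (c : R) : aroot j *m amx w = c *: aroot i ->
    (forall y, phi i (app w y) = c * phi j y) -> acomp (s_ i) w = acomp w (s_ j).
  move=> cj ph; apply: affP => y; rewrite !app_acomp !app_sgen ph.
  rewrite [RHS]appE mulmxBl -scalemxAl cj scalerA addrAC (mulrC c).
  by [].
have Di : desc i (acomp w (s_ j)) = (fa b l (app (s_ j) eta) < 0).
  by rewrite /desc app_acomp /phi e.
have Di' : desc i w = (fa b l eta < 0) by rewrite /desc /phi e.
have [|b0] := ltP (fa b l eta) 0.
  move=> b0; rewrite Di Di' b0 eqb_id -leNgt => b1.
  have h1 : 0 < fa (- b) (- l) eta by rewrite faN oppr_gt0.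
  have h2 : fa (- b) (- l) (app (s_ j) eta) < 0.
    rewrite lt_def faN oppr_le0 b1 andbT eq_sym oppr_eq0.
    have [b' [l' [brs' _ ->]]] := fa_inW l (W_sgen j) brs.
    exact: fa_eta_neq0.
  have [e1 e2] := sgen_separates (rootN brs) h1 h2.
  have ph y : phi i (app w y) = -1 * phi j y.
    by rewrite {1}/phi e /phi -e1 -e2 faN mulN1r opprK.
  split; first by apply: swap ph; rewrite -e1 mulNmx ba scaleN1r.
  have := ph (app (ainv w) eta); rewrite wvE /desc => h3.
  by have := phi_eta i; rewrite h3 mulN1r oppr_gt0 => ->.
have {}b0 : 0 < fa b l eta by rewrite lt_def fa_eta_neq0.
rewrite Di Di' (le_gtF (ltW b0)) eqbF_neg negbK => b1.
have [e1 e2] := sgen_separates brs b0 b1.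
have ph y : phi i (app w y) = 1 * phi j y by rewrite {1}/phi e e1 e2 mul1r.
split; first by apply: swap ph; rewrite -e1 ba scale1r.
have := ph (app (ainv w) eta); rewrite wvE /desc mul1r => <-.
by rewrite ltNge ltW ?phi_eta.
Qed.

(** * Agreement of [lng] with [len], the group Omega, subadditivity *)

Lemma sepAwE w a k : W w -> pos a -> sepAw rs simple a k w <->
  (fa a k eta < 0 /\ 0 < fa a k (app w eta)) \/
  (0 < fa a k eta /\ fa a k (app w eta) < 0).
Proof.
move=> Ww [ars _]; have [b [l [brs _ e]]] := fa_inW k Ww ars.
have faE y : fa a k y = ip y (coroot a) - k%:~R by [].
split=> [[[h1 h2]|[h1 h2]]|].
- by left; rewrite !faE subr_lt0 subr_gt0; split; [apply: h1|apply: h2].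
- by right; rewrite !faE subr_lt0 subr_gt0; split; [apply: h1|apply: h2].
rewrite e => -[[h1 h2]|[h1 h2]]; [left|right]; split=> x xA.
- by rewrite -subr_lt0 -faE fa_alcove.
- by rewrite -subr_gt0 -faE e fa_alcove_gt0.
- by rewrite -subr_gt0 -faE fa_alcove_gt0.
- by rewrite -subr_lt0 -faE e fa_alcove.
Qed.

(** [len] names a hyperplane by its positive root, [separating] by the orientation positive on the
    alcove; [nm] translates between the two names. *)
Lemma len_lng w : W w -> len rs simple w (lng w).
Proof.
move=> Ww; pose nm (p : vec R n * int) := if 0 < ip eta (coroot p.1) then p else (- p.1, - p.2).
have nm_pos p : p.1 \in rs -> pos (nm p).1.
  move=> prs; rewrite /nm; case: (pos_or_neg prs) => pa.
    by rewrite (proj1 (andP (eta_pos pa))).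
  have := proj1 (andP (eta_pos pa)); rewrite corootN ipNr oppr_gt0 => h.
  by rewrite ltNge ltW.
have nm_cases p : nm p = p \/ nm p = (- p.1, - p.2) by rewrite /nm; case: ifP; [left|right].
exists (map nm (separating (app w eta))); split; last 2 first.
- by rewrite size_map.
- move=> a k; split=> [/mapP[[b l] pS e]|[pa]].
    move: pS; rewrite mem_separating /= => /and3P[brs h1 h2].
    have pa : pos a by have := nm_pos (b, l) brs; rewrite -e.
    split=> //; apply/(sepAwE k Ww pa).
    case: (nm_cases (b, l)) => ep; rewrite ep in e; case: e => -> ->; first by right.
    by left; rewrite !faN oppr_lt0 oppr_gt0.
  have [ars _] := pa; have eta_a := proj1 (andP (eta_pos pa)).
  case/(sepAwE k Ww pa) => -[h1 h2].
    apply/mapP; exists (- a, - k); last first.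
      by rewrite /nm /= corootN ipNr oppr_gt0 ltNge (ltW eta_a) /= !opprK.
    by rewrite mem_separating /= rootN // !faN oppr_gt0 oppr_lt0 h1 h2.
  apply/mapP; exists (a, k); last by rewrite /nm /= eta_a.
  by rewrite mem_separating /= ars h1 h2.
rewrite map_inj_in_uniq ?undup_uniq // => p p'.
rewrite !mem_separating => /and3P[_ h1 _] /and3P[_ h2 _].
case: (nm_cases p) => ->; case: (nm_cases p') => -> //; case: p p' h1 h2 => [a k] [a' k'] /= h1 h2.
- by case=> ea ek; move: h1; rewrite ea ek faN oppr_gt0 ltNge (ltW h2).
- by case=> ea ek; move: h2; rewrite -ea -ek faN oppr_gt0 ltNge (ltW h1).
- by case=> /oppr_inj -> /oppr_inj ->.
Qed.

Lemma lenP w m : W w -> len rs simple w m -> m = lng w.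
Proof.
move=> /len_lng[s [us <- hs]] [s' [us' <- hs']].
apply/perm_size/uniq_perm => // -[a k]; apply/idP/idP => h.
  by apply/hs/hs'.
by apply/hs'/hs.
Qed.

Lemma lng0_Omega z : W z -> lng z = 0%N -> inOmega rs simple z.
Proof.
move=> Wz z0; have [Wi vz zv] := W_ainv Wz.
have zA := lng0_alcove Wz z0.
have stable v x : W v -> (forall a k, a \in rs -> 0 < fa a k eta -> 0 < fa a k (app v eta)) ->
    alcove x -> alcove (app v x).
  move=> Wv h xA; apply: fa_gt0_alcove => a k ars /(h _ _ ars).
  have [b [l [brs _ e]]] := fa_inW k Wv ars.
  by rewrite !e fa_alcove_gt0.
have h1 a k : a \in rs -> 0 < fa a k eta -> 0 < fa a k (app z eta).
  by move=> ars; rewrite fa_alcove_gt0.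
split=> // [x|y yA]; first exact: stable.
exists (app (ainv z) y); split; last by rewrite -app_acomp zv app_aid.
apply: stable => // a k ars.
have [b [l [brs _ e]]] := fa_inW k Wi ars.
rewrite e -(fa_alcove_gt0 l zA brs) -e -app_acomp vz app_aid.
by [].
Qed.

Lemma Omega_lng0 z : inOmega rs simple z -> lng z = 0%N.
Proof.
move=> [Wz zA _]; apply/eqP; rewrite -leqn0 leqNgt; apply/negP => /lng_gt0[j].
by rewrite /desc /phi (fa_alcove _ (zA _ Heta) (aroot_root j)) -/(phi j eta) ltNge ltW ?phi_eta.
Qed.

(** A hyperplane separating A from wvA separates A from wA or wA from wvA; those of the second kind
    are pulled back along w, injectively because w is onto. *)
Lemma lng_mul_le w v : W w -> W v -> (lng (acomp w v) <= lng w + lng v)%N.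
Proof.
move=> Ww Wv; have [_ _ wiw] := W_ainv Ww.
have tr (p : vec R n * int) : {p' : vec R n * int | p.1 \in rs ->
    p'.1 \in rs /\ forall y, fa p.1 p.2 (app w y) = fa p'.1 p'.2 y}.
  apply: constructive_indefinite_description.
  have [prs|?] := boolP (p.1 \in rs); last by exists p.
  by have [b [l [brs _ e]]] := fa_inW p.2 Ww prs; exists (b, l).
pose f p := sval (tr p).
have fP p : p.1 \in rs ->
    (f p).1 \in rs /\ forall y, fa p.1 p.2 (app w y) = fa (f p).1 (f p).2 y.
  exact: svalP (tr p).
rewrite {1}/lng /dist; set s := separating _.
pose P (p : vec R n * int) := fa p.1 p.2 (app w eta) < 0.
rewrite -(count_predC P s) -!size_filter leq_add //.
  apply: uniq_leq_size; first exact/filter_uniq/undup_uniq.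
  by move=> p; rewrite mem_filter !mem_separating => /andP[Pp /and3P[-> -> _]].
rewrite -(size_map f); apply: uniq_leq_size => [|p'].
  rewrite map_inj_in_uniq; first exact/filter_uniq/undup_uniq.
  move=> p p'; rewrite !mem_filter !mem_separating.
  move=> /and4P[_ prs _ _] /and4P[_ prs' _ _] e.
  have [] := @fa_ext p.1 p'.1 p.2 p'.2 prs prs'; last first.
    by move=> e1 e2; rewrite [p]surjective_pairing e1 e2 -surjective_pairing.
  move=> y; have yE : app w (app (ainv w) y) = y by rewrite -app_acomp wiw app_aid.
  by rewrite -yE (proj2 (fP _ prs)) (proj2 (fP _ prs')) e.
case/mapP=> p; rewrite mem_filter !mem_separating /= => /and4P[nP prs h1 h2] ->.
have [frs fe] := fP _ prs.
rewrite frs -!fe -app_acomp h2 andbT /=.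
by rewrite lt_def fa_W_neq0 //= leNgt.
Qed.

(** * The two commuting actions on functions on the affine Weyl group *)

Variables (C : numClosedFieldType) (q : aff R n -> C).
Hypothesis Hq : length_multiplicative_params rs simple q.

Notation q_ := (qj simple a0 q).

Lemma q_neq0 w : W w -> q w != 0.
Proof. by case: Hq => h _ _ /h[]. Qed.

Lemma q_lng0 w : W w -> lng w = 0%N -> q w = 1.
Proof. by case: Hq => _ _ h Ww w0; apply: h => //; rewrite -w0; apply: len_lng. Qed.

Lemma q_mul w v : W w -> W v -> lng (acomp w v) = (lng w + lng v)%N ->
  q (acomp w v) = q w * q v.
Proof.
case: Hq => _ h _ Ww Wv e; apply: (h _ _ (lng w) (lng v)) => //; try exact: len_lng.
by rewrite -e; apply/len_lng/W_mul.
Qed.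

Lemma qj_neq0 j : q_ j != 0.
Proof. exact/q_neq0/W_sgen. Qed.

Lemma q_asc j w : W w -> ~~ desc j w -> q (acomp (s_ j) w) = q_ j * q w.
Proof. by move=> Ww dj; rewrite q_mul ?lng_asc ?lng_sgen //; exact: W_sgen. Qed.

(** After replacing w by s_i w if necessary, lengths add on both sides, and [q] of the common
    element is q_i q_w as well as q_w q_j. *)
Lemma qj_conj i j w : W w -> acomp (s_ i) w = acomp w (s_ j) -> q_ i = q_ j.
Proof.
wlog di : w / ~~ desc i w => [hw Ww e|Ww e].
  have [di|] := boolP (desc i w); last by move/hw; apply.
  apply: (hw (acomp (s_ i) w)); first by rewrite desc_sgen // di.
    exact: W_mul (W_sgen i) Ww.
  by rewrite sgenKl -acompA -e sgenKl.
have e1 := q_asc Ww di; have l1 := lng_asc Ww di.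
have e2 : q (acomp w (s_ j)) = q w * q_ j.
  by apply: q_mul => //; [exact: W_sgen | rewrite -e l1 lng_sgen addn1].
by apply: (mulIf (q_neq0 Ww)); rewrite -e1 e e2 mulrC.
Qed.

Lemma ainvM w v : W w -> W v -> ainv (acomp w v) = acomp (ainv v) (ainv w).
Proof.
move=> /W_ainv[_ iw _] /W_ainv[_ iv _]; apply: ainv_eq.
by rewrite acompA -(acompA _ _ w) iw acompw1.
Qed.

Lemma ainvK w : W w -> ainv (ainv w) = w.
Proof. by move=> /W_ainv[_ _ wi]; apply: ainv_eq. Qed.

Lemma ainv_sgen j : ainv (s_ j) = s_ j.
Proof. exact/ainv_eq/sgen2. Qed.

Lemma lng0_desc z : (forall j, desc j z = false) -> lng z = 0%N.
Proof.
move=> h; apply/eqP; rewrite -leqn0 leqNgt; apply/negP => /lng_gt0[j].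
by rewrite h.
Qed.

Lemma lng0_ainv z : W z -> lng z = 0%N -> lng (ainv z) = 0%N.
Proof.
move=> Wz z0; have [Wi iz _] := W_ainv Wz; apply: lng0_desc => j.
by rewrite -(desc_mulr j Wi Wz z0) iz desc1.
Qed.

Implicit Types (F G : aff R n -> C).

Definition chiW j w : C := if desc j w then q_ j else (q_ j)^-1.

Lemma chiW_sgen j w : W w -> chiW j (acomp (s_ j) w) = q_ j + (q_ j)^-1 - chiW j w.
Proof. by move=> Ww; rewrite /chiW desc_sgen //; move: (q_ j) => t; case: desc => /=; ring. Qed.

Definition eqW F G := forall w, W w -> F w = G w.

(* With [c = q_j] this is the action of [T_j] on functions on [W], and with
   [c = q_j^-1] that of its inverse. *)
Definition demazure (c : C) j F w : C := c * F w + chiW j w * (F (acomp (s_ j) w) - F w).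

Definition letter := (option 'I_n + aff R n)%type.

Definition wf (l : letter) : Prop := if l is inr u then W u /\ lng u = 0%N else True.

Definition TW (l : letter) F : aff R n -> C :=
  match l with inl j => demazure (q_ j) j F | inr u => fun w => F (acomp (ainv u) w) end.
Definition TWi (l : letter) F : aff R n -> C :=
  match l with inl j => demazure (q_ j)^-1 j F | inr u => fun w => F (acomp u w) end.

Definition opW (s : seq letter) F := foldr TW F s.
(** The inverse of [opW s]: [foldl] undoes the outermost letter first. *)
Definition opWi (s : seq letter) F := foldl (fun G l => TWi l G) F s.

Fixpoint wfs (s : seq letter) : Prop := if s is l :: s' then wf l /\ wfs s' else True.

Lemma TW_ext l F G : wf l -> eqW F G -> eqW (TW l F) (TW l G).
Proof.
case: l => [j _|u [Wu _]] e w Ww /=.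
  by rewrite /demazure !e //; exact: W_mul (W_sgen j) Ww.
by apply: e; apply: W_mul Ww; case: (W_ainv Wu).
Qed.

Lemma TWi_ext l F G : wf l -> eqW F G -> eqW (TWi l F) (TWi l G).
Proof.
case: l => [j _|u [Wu _]] e w Ww /=.
  by rewrite /demazure !e //; exact: W_mul (W_sgen j) Ww.
by apply: e; apply: W_mul Ww.
Qed.

Lemma opW_ext s F G : wfs s -> eqW F G -> eqW (opW s F) (opW s G).
Proof. by elim: s => [|l s IH] //= [wl ws] e; apply: TW_ext (IH _ _). Qed.

Lemma opWi_ext s F G : wfs s -> eqW F G -> eqW (opWi s F) (opWi s G).
Proof.
by elim: s F G => [|l s IH] F G //= [wl ws] e; apply: IH => //; apply: TWi_ext.
Qed.

(** The values of [chiW] on the two sides of V_j sum to q_j + q_j^-1; with c + d equal to that sum,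
    the coefficient of F(s_j w) cancels. *)
Lemma demazureK c d j F : c * d = 1 -> c + d = q_ j + (q_ j)^-1 ->
  eqW (demazure c j (demazure d j F)) F.
Proof.
move=> cd1 cd w Ww; rewrite /demazure sgenKl chiW_sgen //.
rewrite -cd; set x := chiW _ _.
by transitivity (c * d * F w); [ring | rewrite cd1 mul1r].
Qed.

Lemma TWK l F : wf l -> eqW (TW l (TWi l F)) F.
Proof.
case: l => [j _|u [Wu _] w Ww] /=; first by apply: demazureK; rewrite ?divff ?qj_neq0.
by have [_ _ ui] := W_ainv Wu; rewrite acompA ui acomp1w.
Qed.

Lemma TWiK l F : wf l -> eqW (TWi l (TW l F)) F.
Proof.
case: l => [j _|u [Wu _] w Ww] /=.
  by apply: demazureK; rewrite ?mulVf ?qj_neq0 // addrC.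
by have [_ iu _] := W_ainv Wu; rewrite acompA iu acomp1w.
Qed.

Lemma opWK s F : wfs s -> eqW (opW s (opWi s F)) F.
Proof.
elim: s F => [|l s IH] F //= [wl ws] w Ww; rewrite -/(opWi s _) -/(opW s _).
by rewrite (TW_ext wl (IH _ ws)) // TWK.
Qed.

Lemma opWiK s F : wfs s -> eqW (opWi s (opW s F)) F.
Proof.
elim: s F => [|l s IH] F //= [wl ws] w Ww; rewrite -/(opWi s _) -/(opW s _).
by rewrite (opWi_ext ws (TWiK _ wl)) // IH.
Qed.

(* Up to a multiple of the identity, the action of [T_j] from the right. *)
Definition demazureR j F w : C := chiW j (ainv w) * (F (acomp w (s_ j)) - F w).
Definition shiftR z F w : C := F (acomp w z).

(** If s_i w = w s_j, both operators mix the same two values with the same coefficients, so they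
    differ there by a multiple of the identity. Otherwise, by [desc_switch] for w and for w^-1,
    neither changes the coefficient of the other. *)
Lemma TWi_demazureR l j F : wf l -> eqW (TWi l (demazureR j F)) (demazureR j (TWi l F)).
Proof.
case: l => [i _|u [Wu u0]] w Ww /=; last first.
  rewrite /demazureR acompA; congr (_ * _); rewrite /chiW.
  have [Wiu uiu _] := W_ainv Wu; have [Wiw _ _] := W_ainv Ww.
  rewrite ainvM // -(desc_mulr j _ Wu u0); last exact: W_mul.
  by rewrite -acompA uiu acompw1.
have [Wiw iw wi] := W_ainv Ww.
have Wwj : W (acomp w (s_ j)) := W_mul Ww (W_sgen j).
rewrite /demazure /demazureR ainvM ?ainv_sgen //; last exact: W_sgen.
have [e|ne] := excluded_middle_informative (acomp (s_ i) w = acomp w (s_ j)).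
  have qe := qj_conj Ww e.
  have e' : acomp (ainv w) (s_ i) = acomp (s_ j) (ainv w).
    by rewrite -[LHS]acompw1 -wi acompA -(acompA _ _ w) e acompA iw acomp1w.
  have de : desc i w = desc j (ainv w).
    apply: (proj2 (@desc_switch i j w Ww _)).
    by rewrite -e desc_sgen //; case: desc.
  have ce : chiW j (ainv w) = chiW i w by rewrite /chiW -de qe.
  have e2 : acomp (acomp (s_ i) w) (s_ j) = w by rewrite e -acompA sgen2 acompw1.
  by rewrite e' e2 -e sgenKl !chiW_sgen // ce -qe; ring.
have di : desc i (acomp w (s_ j)) = desc i w.
  by apply/eqP/negPn/negP => /(desc_switch Ww)[].
have dj : desc j (acomp (ainv w) (s_ i)) = desc j (ainv w).
  apply/eqP/negPn/negP => /(desc_switch Wiw)[e' _]; apply: ne.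
  by rewrite -[LHS]acomp1w -wi -[RHS]acompw1 -iw !acompA -(acompA w (s_ j)) e' -!acompA.
have ci : chiW i (acomp w (s_ j)) = chiW i w by rewrite /chiW di.
have cj : chiW j (acomp (ainv w) (s_ i)) = chiW j (ainv w) by rewrite /chiW dj.
by rewrite ci cj acompA; ring.
Qed.

Lemma TWi_shiftR l z F : wf l -> W z -> lng z = 0%N ->
  eqW (TWi l (shiftR z F)) (shiftR z (TWi l F)).
Proof.
case: l => [i _|u [Wu u0]] Wz z0 w Ww /=; last by rewrite /shiftR acompA.
by rewrite /demazure /shiftR acompA /chiW desc_mulr.
Qed.

(** * Independence of the reduced word *)

Lemma opWi_comm (M : (aff R n -> C) -> aff R n -> C) :
  (forall l F, wf l -> eqW (TWi l (M F)) (M (TWi l F))) ->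
  forall s F, wfs s -> eqW (opWi s (M F)) (M (opWi s F)).
Proof.
move=> hM; elim=> [|l s IH] F //= [wl ws] w Ww; rewrite -!/(opWi s _).
by rewrite (opWi_ext ws (hM _ _ wl)) // IH.
Qed.

(** Letters of length zero may stand anywhere, so that multiplying by an element of Omega on the
    left just prefixes a letter. *)
Inductive reduced : aff R n -> seq letter -> Prop :=
| reduced_nil : reduced (aid R n) [::]
| reduced_sgen j w s : reduced w s -> ~~ desc j w -> reduced (acomp (s_ j) w) (inl j :: s)
| reduced_Omega u w s : reduced w s -> W u -> lng u = 0%N ->
    lng (acomp u w) = lng w -> reduced (acomp u w) (inr u :: s).

Lemma reduced_W w s : reduced w s -> W w /\ wfs s.
Proof.
elim=> [|j v t _ [Wv wt] _|u v t _ [Wv wt] Wu u0 _] /=.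
- by split=> //; apply: inW1.
- by split=> //; apply: W_mul (W_sgen j) Wv.
- by split=> //; apply: W_mul.
Qed.

(* Going up, [T_j^-1] does not see the diagonal term, so the inverse of a reduced
   word evaluates at the identity to a single value. *)
Lemma opWi_aid w s F : reduced w s -> opWi s F (aid R n) = (q w)^-1 * F w.
Proof.
move=> rws; elim: rws F => [|j v t rv IH dj|u v t rv IH Wu u0 uv] F.
- by rewrite q_lng0 ?invr1 ?mul1r ?lng1 //; apply: inW1.
- have [Wv _] := reduced_W rv.
  rewrite /= -/(opWi t _) IH /= /demazure /chiW (negPf dj) q_asc // invfM; ring.
- have [Wv _] := reduced_W rv.
  by rewrite /= -/(opWi t _) IH q_mul // ?u0 // (q_lng0 Wu u0) mul1r.
Qed.

Lemma opWi_reduced w s s' F : reduced w s -> reduced w s' -> eqW (opWi s F) (opWi s' F).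
Proof.
move=> rs1 rs2; have [_ ws] := reduced_W rs1; have [_ ws'] := reduced_W rs2.
(* Passing to z = v^-1 turns right factors of v into left factors of z, to which [desc] applies; the
   induction is on the length of z, for all F at once. *)
move=> v Wv; have [Wi _ _] := W_ainv Wv; rewrite -[v]ainvK //.
move: {v Wv}(ainv v) Wi => z Wz.
move: {2}(lng z) (erefl (lng z)) => m; elim: m z F Wz => [|m IH] z F Wz zm.
  have [Wi _ _] := W_ainv Wz; have i0 := lng0_ainv Wz zm.
  have key t : wfs t -> opWi t F (ainv z) = opWi t (shiftR (ainv z) F) (aid R n).
    move=> wt; rewrite (opWi_comm (M := shiftR (ainv z))) ?/shiftR ?acomp1w //.
      by move=> l G wl; apply: TWi_shiftR.
    exact: inW1.
  by rewrite !key // (opWi_aid _ rs1) (opWi_aid _ rs2).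
have [|j dj] := @lng_gt0 z; first by rewrite zm.
pose z' := acomp (s_ j) z; have Wz' : W z' := W_mul (W_sgen j) Wz.
have z'm : lng z' = m by have := lng_desc dj; rewrite zm => -[].
have dj' : desc j z' = false by rewrite desc_sgen // dj.
have zE : ainv z = acomp (ainv z') (s_ j).
  by rewrite -(ainv_sgen j) -ainvM ?sgenKl //; exact: W_sgen.
have [Wi _ _] := W_ainv Wz'.
(* At z'^-1 the coefficient in [demazureR j] is q_j^-1, which is nonzero, so its definition can be
   solved for the value at z^-1. The induction hypothesis then serves both F and [demazureR j F]. *)
have key t : wfs t -> opWi t F (ainv z) =
    opWi t F (ainv z') + q_ j * opWi t (demazureR j F) (ainv z').
  move=> wt; rewrite (opWi_comm (M := demazureR j)) //; last first.
    by move=> l G wl; apply: TWi_demazureR.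
  rewrite /demazureR -zE ainvK // /chiW dj' mulrA divff ?qj_neq0 // mul1r.
  by rewrite addrCA subrr addr0.
by rewrite !key // !IH.
Qed.

Lemma opW_reduced w s s' F : reduced w s -> reduced w s' -> eqW (opW s F) (opW s' F).
Proof.
move=> rs1 rs2 v Wv; have [_ ws] := reduced_W rs1; have [_ ws'] := reduced_W rs2.
rewrite -[LHS](opW_ext ws (opWiK F ws')) //.
by rewrite (opW_ext ws (opWi_reduced _ rs2 rs1)) // opWK.
Qed.

(** * Pulling back from the weight lattice *)

Local Notation That := (That simple a0 q).
Implicit Types f g : fnP rs C.

Lemma ext_val f (p : Pt rs) : ext f (val p) = f p.
Proof. by rewrite /ext valK. Qed.

Lemma ext_insub f y (yP : inP rs y) : ext f y = f (Sub y yP).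
Proof. by rewrite -ext_val SubK. Qed.

Lemma sepPtE j y : sepPt rs simple a0 j y <-> phi j y < 0.
Proof.
have h := proj1 (andP (eta_pos (hroot_pos j))).
have h' := proj2 (andP (eta_pos (hroot_pos j))).
rewrite /sepPt; case: j h h' => [i|] /= h h'; rewrite ?phi_Some ?phi_None ?mulr0z ?mulr1z; split.
- by case=> -[+ //] => /(_ _ Heta); rewrite ltNge (ltW h).
- by move=> h2; right; split=> // x xA; case/andP: (xA _ (simple_pos i)).
- by case=> -[]; [rewrite subr_lt0|move=> /(_ _ Heta); rewrite ltNge (ltW h')].
- rewrite subr_lt0 => h2; left; split=> // x xA; by case/andP: (xA _ a0_pos).
Qed.

Lemma chiE j y : chi rs simple a0 q j y =
  if phi j y == 0 then 1 else if phi j y < 0 then q_ j else (q_ j)^-1.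
Proof.
rewrite /chi; have -> : (ip y (coroot (hroot simple a0 j)) == (hk j)%:~R) = (phi j y == 0).
  case: j => [i|]; rewrite ?phi_Some ?phi_None //= mulr1z.
  by rewrite subr_eq0 eq_sym.
case: (phi j y == 0) => //; case: excluded_middle_informative => [/sepPtE ->//|].
by move=> h; case: ifP => // /sepPtE.
Qed.

Lemma ext_That j f y : inP rs y ->
  ext (That j f) y = q_ j * ext f y + chi rs simple a0 q j y * (ext f (app (s_ j) y) - ext f y).
Proof.
by move=> yP; rewrite !(ext_insub _ yP) /Defs.That /act ainv_sgen.
Qed.

Lemma ext_act u f y : inP rs y -> ext (act u f) y = ext f (app (ainv u) y).
Proof. by move=> yP; rewrite (ext_insub _ yP). Qed.

Definition TP (l : letter) f : fnP rs C :=
  match l with inl j => That j f | inr u => act u f end.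
Definition opP (s : seq letter) f : fnP rs C := foldr TP f s.

(* For [x] in the closed alcove, restriction to the orbit of [x] intertwines the
   operators on [C(P)] with those on functions on [W]; where [w x] lies on [V_j],
   both give [q_j f(w x)], whatever side of [V_j] the alcove [w A] is on. *)
Lemma ext_opP x : inP rs x -> (forall j, 0 <= phi j x) ->
  forall s f v, wfs s -> W v ->
  ext (opP s f) (app v x) = opW s (fun w => ext f (app w x)) v.
Proof.
move=> xP xA s f; elim: s => [|[j|u] s IH] v //= [wl ws] Wv; last first.
  case: wl => Wu _; have [Wi _ _] := W_ainv Wu.
  rewrite ext_act; last exact: W_inP.
  by rewrite -app_acomp IH //; apply: W_mul.
have vxP := W_inP Wv xP.
have Wsv : W (acomp (s_ j) v) := W_mul (W_sgen j) Wv.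
rewrite ext_That // -app_acomp /demazure -!/(opW s _) -!IH //.
congr (_ + _); rewrite chiE /chiW /desc.
have [b [l [brs _ e]]] := fa_inW (alevel j) Wv (aroot_root j).
have ph y : phi j (app v y) = fa b l y by rewrite /phi e.
have [z0|nz] := eqVneq (phi j (app v x)) 0.
  by rewrite app_acomp app_sgen z0 scale0r subr0 subrr !mulr0.
congr (_ * _); congr (if _ then _ else _).
(* Off the wall, the affine coroot pulled back along v has the same strict sign at [x] as at [eta],
   because [x] lies in the closed alcove. *)
rewrite !ph in nz *; have [eta0|eta0] := ltP (fa b l eta) 0.
  have := closure_fa_ge0 (k := - l) xA (rootN brs); rewrite !faN oppr_gt0 oppr_ge0 => /(_ eta0).
  by rewrite lt_def eq_sym nz => ->.
apply/le_gtF/closure_fa_ge0 => //.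
by rewrite lt_def fa_eta_neq0.
Qed.

(** Reflecting in a violated wall lowers [dist], so the process ends in the closed alcove. *)
Lemma W_closure y : inP rs y ->
  exists v x, [/\ W v, inP rs x, forall j, 0 <= phi j x & y = app v x].
Proof.
move: {2}(dist y) (erefl (dist y)) => m; elim: m y => [|m IH] y ym yP.
  exists (aid R n), y; split; rewrite ?app_aid //; first exact: inW1.
  by move=> j; rewrite leNgt; apply/negP => /dist_sgen; rewrite ym.
have [|j pj] := @dist_gt0 y; first by rewrite ym.
have := dist_sgen pj; rewrite ym => -[/esym e].
have [v [x [Wv xP xA yE]]] := IH _ e (W_inP (W_sgen j) yP).
exists (acomp (s_ j) v), x; split=> //; first exact: W_mul (W_sgen j) Wv.
by rewrite app_acomp -yE sgenK.
Qed.

Lemma opP_reduced w s s' f : reduced w s -> reduced w s' -> opP s f = opP s' f.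
Proof.
move=> rs1 rs2; have [_ ws] := reduced_W rs1; have [_ ws'] := reduced_W rs2.
apply: functional_extensionality => p.
have [v [x [Wv xP xA pE]]] := W_closure (valP p).
by rewrite -!ext_val pE !ext_opP // (opW_reduced _ rs1 rs2).
Qed.

(** * The operators indexed by [W], the Hecke relations and uniqueness *)

Lemma reduced_exists w : W w -> exists s, reduced w s.
Proof.
move: {2}(lng w) (erefl (lng w)) => m; elim: m w => [|m IH] w wm Ww.
  exists [:: inr w]; rewrite -[w in reduced w _]acompw1.
  by apply: reduced_Omega; rewrite ?acompw1 ?lng1 //; apply: reduced_nil.
have [|j dj] := @lng_gt0 w; first by rewrite wm.
have := lng_desc dj; rewrite wm => -[/esym e].
have [s rw] := IH _ e (W_mul (W_sgen j) Ww).
exists (inl j :: s); rewrite -(sgenKl j w); apply: reduced_sgen => //.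
by rewrite desc_sgen // dj.
Qed.

(** [epsilon] picks some reduced word; [hecke_opE] replaces it by any other. *)
Definition hecke_op (w : aff R n) : fnP rs C -> fnP rs C :=
  opP (epsilon (inhabits [::]) (reduced w)).

Lemma hecke_opE w s f : reduced w s -> hecke_op w f = opP s f.
Proof.
move=> rw; have rw' : reduced w (epsilon (inhabits [::]) (reduced w)).
  by apply: epsilon_spec; exists s.
exact: opP_reduced rw' rw.
Qed.

Lemma hecke_op_sgen_mul j w f : W w -> ~~ desc j w ->
  hecke_op (acomp (s_ j) w) f = That j (hecke_op w f).
Proof.
move=> /reduced_exists[s rw] dj.
by rewrite (hecke_opE _ (reduced_sgen rw dj)) (hecke_opE _ rw).
Qed.

Lemma hecke_op_Omega_mul u w f : W u -> lng u = 0%N -> W w ->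
  lng (acomp u w) = lng w -> hecke_op (acomp u w) f = act u (hecke_op w f).
Proof.
move=> Wu u0 /reduced_exists[s rw] e.
by rewrite (hecke_opE _ (reduced_Omega rw Wu u0 e)) (hecke_opE _ rw).
Qed.

Lemma hecke_op1 f : hecke_op (aid R n) f = f.
Proof. by rewrite (hecke_opE _ reduced_nil). Qed.

Lemma hecke_op_sgen j f : hecke_op (s_ j) f = That j f.
Proof.
by rewrite -[s_ j]acompw1 hecke_op_sgen_mul ?desc1 ?hecke_op1 //; exact: inW1.
Qed.

Lemma hecke_op_Omega u f : W u -> lng u = 0%N -> hecke_op u f = act u f.
Proof.
move=> Wu u0; rewrite -[u in hecke_op u]acompw1 hecke_op_Omega_mul ?hecke_op1 //.
  exact: inW1.
by rewrite acompw1 lng1.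
Qed.

Lemma hecke_op_mul w v f : W w -> W v -> lng (acomp w v) = (lng w + lng v)%N ->
  hecke_op (acomp w v) f = hecke_op w (hecke_op v f).
Proof.
move: {2}(lng w) (erefl (lng w)) => m; elim: m w => [|m IH] w wm Ww Wv e.
  by rewrite (hecke_op_Omega _ Ww wm) hecke_op_Omega_mul // e wm.
have [|j dj] := @lng_gt0 w; first by rewrite wm.
set w1 := acomp (s_ j) w; have wE : w = acomp (s_ j) w1 by rewrite sgenKl.
have Ww1 : W w1 := W_mul (W_sgen j) Ww.
have w1m : lng w1 = m by have := lng_desc dj; rewrite wm => -[].
have dj1 : ~~ desc j w1 by rewrite desc_sgen // dj.
have Ww1v := W_mul Ww1 Wv.
have wvE : acomp w v = acomp (s_ j) (acomp w1 v) by rewrite acompA -wE.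
have le := lng_mul_le Ww1 Wv.
(* Were s_j to shorten w1 v, then wv would be shorter than w1 v, whose length is at most that of w1
   plus that of v, against additivity for w and v. *)
have dj2 : ~~ desc j (acomp w1 v).
  apply/negP => /lng_desc; rewrite -wvE e wm; lia.
have e1 : lng (acomp w1 v) = (lng w1 + lng v)%N.
  have := lng_asc Ww1v dj2; rewrite -wvE e wm; lia.
rewrite wvE hecke_op_sgen_mul // IH //.
by rewrite [in RHS]wE [RHS]hecke_op_sgen_mul.
Qed.

Lemma act_linear u (c : C) f g p :
  act u (fun x : Pt rs => c * f x + g x) p = c * act u f p + act u g p.
Proof. by rewrite /act /ext; case: insubP => [//|_]; rewrite mulr0 addr0. Qed.

Lemma TP_linear l (c : C) f g p :
  TP l (fun x : Pt rs => c * f x + g x) p = c * TP l f p + TP l g p.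
Proof.
case: l => [j|u] /=; last exact: act_linear.
rewrite /Defs.That act_linear; ring.
Qed.

Lemma hecke_op_linear w (c : C) f g p :
  hecke_op w (fun x : Pt rs => c * f x + g x) p = c * hecke_op w f p + hecke_op w g p.
Proof.
rewrite /hecke_op; move: (epsilon _ _) => s; elim: s p => [|l s IH] p //=.
rewrite -!/(opP s _) -TP_linear; congr (TP _ _ _).
exact: functional_extensionality.
Qed.

Lemma That_quadratic j f p :
  That j (fun x : Pt rs => That j f x + (q_ j)^-1 * f x) p -
  q_ j * (That j f p + (q_ j)^-1 * f p) = 0.
Proof.
pose y := val p; have yP : inP rs y := valP p.
have syP := W_inP (W_sgen j) yP.
pose g : fnP rs C := fun x : Pt rs => That j f x + (q_ j)^-1 * f x.
change (That j g p - q_ j * g p = 0).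
have gE z : inP rs z -> ext g z = ext (That j f) z + (q_ j)^-1 * ext f z.
  by move=> zP; rewrite !(ext_insub _ zP).
rewrite -[That j g p]ext_val -(ext_val g) -/y ext_That //.
(* What remains is chi_j(y) (g(s_j y) - g(y)). Off the wall g(y) = chi_j(s_j y) f(y) + chi_j(y)
   f(s_j y), which is symmetric under s_j; on it s_j y = y. *)
rewrite addrAC subrr add0r !gE // !ext_That // sgenK !chiE phi_sgen oppr_eq0 oppr_lt0.
have [z0|nz] := eqVneq (phi j y) 0.
  by rewrite app_sgen z0 scale0r subr0 subrr mulr0.
move: (q_ j) (ext f y) (ext f _) => t A B.
by case: ltgtP nz => //= _ _; ring.
Qed.

Lemma hecke_op_rep : hecke_rep (rs := rs) simple a0 q hecke_op.
Proof.
split=> [w _ c f g p|f p|w v a b Ww Wv wa vb wvab f p|j f p].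
- exact: hecke_op_linear.
- by rewrite hecke_op1.
- rewrite hecke_op_mul // -(lenP Ww wa) -(lenP Wv vb).
  by rewrite -(lenP (W_mul Ww Wv) wvab).
- have -> : hecke_op (s_ j) = That j.
    by apply: functional_extensionality => h; exact: hecke_op_sgen.
  exact: That_quadratic.
Qed.

Lemma hecke_op_extends : extends_generators (rs := rs) simple a0 q hecke_op.
Proof.
split=> [j f p|u uO f p]; first by rewrite hecke_op_sgen.
by rewrite hecke_op_Omega ?Omega_lng0 //; case: uO.
Qed.

Lemma hecke_rep_unique (rho : aff R n -> fnP rs C -> fnP rs C) :
  hecke_rep (rs := rs) simple a0 q rho ->
  extends_generators (rs := rs) simple a0 q rho ->
  forall w, W w -> forall f p, rho w f p = hecke_op w f p.
Proof.
move=> [_ _ rhoM _] [rho_s rho_O] w.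
move: {2}(lng w) (erefl (lng w)) => m; elim: m w => [|m IH] w wm Ww f p.
  by rewrite rho_O ?hecke_op_Omega //; exact: lng0_Omega.
have [|j dj] := @lng_gt0 w; first by rewrite wm.
set w1 := acomp (s_ j) w; have wE : w = acomp (s_ j) w1 by rewrite sgenKl.
have Ww1 : W w1 := W_mul (W_sgen j) Ww.
have w1m : lng w1 = m by have := lng_desc dj; rewrite wm => -[].
have dj1 : ~~ desc j w1 by rewrite desc_sgen // dj.
have rE : rho w1 f = hecke_op w1 f.
  by apply: functional_extensionality => l; exact: IH.
rewrite wE (rhoM _ _ 1%N m) //; last 4 first.
- exact: W_sgen.
- by have := len_lng (W_sgen j); rewrite lng_sgen.
- by rewrite -w1m; exact: len_lng.
- by rewrite -wE -[(1 + m)%N]wm; exact: len_lng.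
by rewrite rho_s rE hecke_op_sgen_mul.
Qed.
End Alcove.

Theorem mainTheorem1 (R : archiRealFieldType) (C : numClosedFieldType) (n : nat)
    (rs : seq 'rV[R]_n) (simple : 'I_n -> 'rV[R]_n) (a0 : 'rV[R]_n)
    (q : aff R n -> C)
    (Hrs : irreducible_reduced_crystallographic_root_system rs)
    (Hsimple : simple_system rs simple)
    (Ha0 : highest_coroot rs simple a0)
    (Hq : length_multiplicative_params rs simple q) :
  exists rho : aff R n -> fnP rs C -> fnP rs C,
    [/\ hecke_rep (rs:=rs) simple a0 q rho,
        extends_generators (rs:=rs) simple a0 q rho &
        forall rho' : aff R n -> fnP rs C -> fnP rs C,
          hecke_rep (rs:=rs) simple a0 q rho' -> extends_generators (rs:=rs) simple a0 q rho' ->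
          forall w, inW rs w -> forall f l, rho' w f l = rho w f l].
Proof.
have [eta Heta] := alcove_nonempty Hrs Hsimple.
exists (hecke_op (rs := rs) simple a0 eta q); split.
- exact: (hecke_op_rep Hrs Hsimple Ha0 Heta Hq).
- exact: (hecke_op_extends Hrs Hsimple Ha0 Heta Hq).
- exact: (hecke_rep_unique Hrs Hsimple Ha0 Heta Hq).
Qed.
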